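(* If $S$ is a translation surface obtained from a triangle all of whose angles are rational multiples of $\pi$ via the Zemlyakov–Katok construction, then $S$ is completely algebraically periodic.
   Context: A translation surface is a compact (connected, oriented) surface $S$ obtained by gluing finitely many polygons in $\mathbb{R}^2$ along parallel edges by translations; $\Sigma$ denotes its set of singular points. View $\mathbb{R}^2$ and $\mathbb{R}$ as $\mathbb{Q}$-vector spaces. Take an edge-to-edge decomposition of $S$ into Euclidean triangles $\Delta_j$ whose vertex set contains $\Sigma$, and let $v_j,w_j\in\mathbb{R}^2$ be two successive sides of $\Delta_j$ in counterclockwise order. The $J$-invariant is $J(S)=\sum_j v_j\wedge w_j\in\mathbb{R}^2\wedge_{\mathbb{Q}}\mathbb{R}^2$ (independent of the triangulation). For $0\ne v\in\mathbb{R}^2$ let $\pi:\mathbb{R}^2\to\mathbb{R}$ be the orthogonal projection with kernel $\mathbb{R}v$, and let $\mathrm{SAF}_v(S)\in\mathbb{R}\wedge_{\mathbb{Q}}\mathbb{R}$ be the image of $J(S)$ under the map induced by $\pi$. The direction $v$ is algebraically periodic if $\mathrm{SAF}_v(S)=0$. The holonomy of $S$ is the image of $\mathrm{hol}:H_1(S,\Sigma;\mathbb{Q})\to\mathbb{R}^2$, $\sigma\mapsto(\int_\sigma dx,\int_\sigma dy)$. A homological direction is the direction of a non-zero vector in the holonomy. $S$ is completely algebraically periodic if every homological direction is algebraically periodic. Zemlyakov–Katok construction (unfolding): given a polygon $P\subset\mathbb{R}^2$ with angles rational multiples of $\pi$, let $G\subset O(2)$ be the finite group generated by the linear parts of the reflections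 in the sides of $P$. Take one copy $gP$ for each $g\in G$, and for each side $e$ of $P$, with $r_e$ the linear part of the reflection in $e$, glue the side $g(e)$ of $gP$ by translation to the corresponding side of the copy $g r_e P$. The result is a translation surface. *)

(* Defs.v *)
From HB Require Import structures.
From mathcomp Require Import all_boot all_order all_algebra.
From mathcomp Require Import generic_quotient ring_quotient finmap freeg.
From mathcomp Require Import boolp classical_sets cardinality reals trigo.
From mathcomp Require Import ring lra.
Set Implicit Arguments.
Unset Strict Implicit.
Unset Printing Implicit Defensive.
Import Order.TTheory GRing.Theory Num.Theory.
Local Open Scope ring_scope.
Local Open Scope quotient_scope.

(* A vector space [V] over a field [F] of characteristic zero is viewed as a
   Q-vector space through [ratr : rat -> F].  Its exterior square over Q is
   the free Q-vector space on [V * V] modulo the relations that make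
   [(u, w) |-> u /\ w] Q-bilinear and alternating. *)

Section ExteriorSquare.
Variables (F : numFieldType) (V : lmodType F).

Inductive ext2_relation : {freeg (V * V) / rat} -> Prop :=
| Ext2_linl (a : rat) (u u' w : V) :
    ext2_relation (<< (ratr a *: u + u', w) >>
                   - (a *: << (u, w) >> + << (u', w) >>))
| Ext2_linr (a : rat) (u w w' : V) :
    ext2_relation (<< (u, ratr a *: w + w') >>
                   - (a *: << (u, w) >> + << (u, w') >>))
| Ext2_alt (u : V) : ext2_relation << (u, u) >>
| Ext2_zero : ext2_relation 0
| Ext2_comb (a : rat) x y :
    ext2_relation x -> ext2_relation y -> ext2_relation (a *: x + y).

Definition ext2_null : {pred {freeg (V * V) / rat}} :=
  fun x => `[< ext2_relation x >].

Fact ext2_null_zmod_closed : zmod_closed ext2_null.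
Proof.
split=> [|x y]; first by apply/asboolP; constructor.
move=> /asboolP hx /asboolP hy; apply/asboolP.
by have := Ext2_comb (-1) hy hx; rewrite scaleN1r addrC.
Qed.

HB.instance Definition _ :=
  GRing.isZmodClosed.Build {freeg (V * V) / rat} ext2_null
    ext2_null_zmod_closed.

Definition ext2 := Quotient.quot ext2_null.
HB.instance Definition _ := GRing.Zmodule.on ext2.
HB.instance Definition _ := Quotient.on ext2.

Definition wedge (u w : V) : ext2 := \pi_ext2 << (u, w) >>.

End ExteriorSquare.
Arguments ext2_null {F V}.
Arguments ext2 {F} V.

Section ExteriorSquareMap.
Variables (F : numFieldType) (V W : lmodType F) (f : {linear V -> W}).

Definition freeg_map2 : {freeg (V * V) / rat} -> {freeg (W * W) / rat} :=
  fglift (fun p => << (f p.1, f p.2) >>).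

(* The map induced by [f] on the exterior squares.  It does not depend on the
   chosen representatives and is determined by [ext2_map_wedge] and
   [ext2_map_zmod_morphism]. *)
Definition ext2_map (x : ext2 V) : ext2 W := \pi_(ext2 W) (freeg_map2 (repr x)).

Lemma freeg_map2B : {morph freeg_map2 : x y / x - y}.
Proof. exact: lift_is_additive. Qed.

Lemma freeg_map2_0 : freeg_map2 0 = 0.
Proof. by rewrite -[0 in LHS](subrr 0) freeg_map2B subrr. Qed.

Lemma freeg_map2N : {morph freeg_map2 : x / - x}.
Proof. by move=> x; rewrite -[- x]sub0r freeg_map2B freeg_map2_0 sub0r. Qed.

Lemma freeg_map2D : {morph freeg_map2 : x y / x + y}.
Proof.
by move=> x y; rewrite -[y in LHS]opprK freeg_map2B freeg_map2N opprK.
Qed.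

Lemma freeg_map2U k p :
  freeg_map2 << k *g p >> = k *: << (f p.1, f p.2) >>.
Proof. exact: liftU. Qed.

Lemma freeg_map2U1 p : freeg_map2 << p >> = << (f p.1, f p.2) >>.
Proof. by rewrite freeg_map2U scale1r. Qed.

Lemma freegZU (K : choiceType) (a k : rat) (p : K) :
  a *: << k *g p >> = << (a * k) *g p >> :> {freeg K / rat}.
Proof.
by apply/eqP/freeg_eqP => x; rewrite coeffZ !coeffU mulrA.
Qed.

Lemma freeg_map2Z (a : rat) : {morph freeg_map2 : x / a *: x}.
Proof.
move=> x; rewrite -[x]freeg_sumE scaler_sumr.
pose big := big_morph _ freeg_map2D freeg_map2_0.
rewrite !big scaler_sumr; apply: eq_bigr => z _.
by rewrite freegZU !freeg_map2U scalerA.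
Qed.

Lemma ext2_relation_map x : ext2_relation x -> ext2_relation (freeg_map2 x).
Proof.
elim=> [a u u' w|a u w w'|u||a {}x y _ hx _ hy].
- rewrite freeg_map2B freeg_map2D freeg_map2Z !freeg_map2U1 /= linearP.
  exact: Ext2_linl.
- rewrite freeg_map2B freeg_map2D freeg_map2Z !freeg_map2U1 /= linearP.
  exact: Ext2_linr.
- by rewrite freeg_map2U1; apply: Ext2_alt.
- by rewrite freeg_map2_0; apply: Ext2_zero.
- by rewrite freeg_map2D freeg_map2Z; apply: Ext2_comb.
Qed.

Lemma ext2_map_pi x : ext2_map (\pi_(ext2 V) x) = \pi_(ext2 W) (freeg_map2 x).
Proof.
rewrite /ext2_map; case: piP => y /eqP.
rewrite -Quotient.idealrBE => /asboolP/ext2_relation_map.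
rewrite freeg_map2B => xy.
apply/esym/eqP; rewrite -Quotient.idealrBE; exact/asboolP.
Qed.

Lemma ext2_map_wedge u w : ext2_map (wedge u w) = wedge (f u) (f w).
Proof. by rewrite ext2_map_pi freeg_map2U1. Qed.

Lemma ext2_map_zmod_morphism : zmod_morphism ext2_map.
Proof.
move=> x y; rewrite -[x]reprK -[y]reprK -[LHS]/(ext2_map _).
have pB (U : lmodType F) (a b : {freeg (U * U) / rat}) :
  \pi_(ext2 U) a - \pi_(ext2 U) b = \pi_(ext2 U) (a - b).
  by rewrite !piE.
by rewrite pB !ext2_map_pi freeg_map2B pB.
Qed.

End ExteriorSquareMap.

(* Points and vectors of the plane are column vectors, so that a matrix acts
   on the left.  [`|u|] is the sup norm of a matrix, hence [enorm]. *)

Section Plane.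
Variable R : realType.
Implicit Types u v w : 'cV[R]_2.

Definition dot u w : R := \sum_i u i 0 * w i 0.
Definition cross u w : R := u 0 0 * w 1 0 - u 1 0 * w 0 0.
Definition enorm u : R := Num.sqrt (dot u u).

(* The unoriented angle, in [0, pi], between two non-zero vectors. *)
Definition angle u w : R := acos (dot u w / (enorm u * enorm w)).

(* The linear reflection in the line spanned by [u != 0]. *)
Definition reflection u : 'M[R]_2 := (2 / dot u u) *: (u *m u^T) - 1%:M.

(* The orthogonal projection with kernel [R v], for [v != 0]: the coordinate on
   the line orthogonal to [v] in its unit basis vector (-v_1, v_0) / |v|.  The
   codomain is [R] viewed as a vector space over itself. *)
Definition oproj v (u : 'cV[R]_2) : R^o := cross v u / enorm v.

Fact oproj_is_linear v : linear (oproj v).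
Proof.
move=> a u w; rewrite /oproj /cross !mxE /GRing.scale /=; ring.
Qed.
HB.instance Definition _ v :=
  GRing.isLinear.Build R 'cV[R]_2 R^o *:%R (oproj v) (oproj_is_linear v).

End Plane.

(* A translation surface is presented by an edge-to-edge triangulation.  The
   boundary of the triangle [t] is traversed counterclockwise by the vectors
   [ts_side t 0], [ts_side t 1], [ts_side t 2]; indices in ['I_3] are added
   modulo 3.  [ts_glue (t, i) = (t', i')] means that the [i]-th side of [t] is
   glued by translation to the [i']-th side of [t'], so that these sides are
   opposite as boundary vectors.  Every point other than a vertex of the
   triangulation is regular. *)

Record translation_surface (R : realType) := TranslationSurface {
  ts_triangle : finType;
  ts_side : ts_triangle -> 'I_3 -> 'cV[R]_2;
  ts_glue : ts_triangle * 'I_3 -> ts_triangle * 'I_3;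
  ts_side_sum : forall t, \sum_i ts_side t i = 0;
  ts_side_ccw : forall t, 0 < cross (ts_side t 0) (ts_side t 1);
  ts_glueK : involutive ts_glue;
  ts_glue_side : forall s,
    ts_side (ts_glue s).1 (ts_glue s).2 = - ts_side s.1 s.2;
  ts_inhabited : (0 < #|ts_triangle|)%N;
  ts_connected : forall t t',
    connect (fun a b => [exists i, (ts_glue (a, i)).1 == b]) t t'
}.

Section Invariants.
Variables (R : realType) (S : translation_surface R).

Definition J_invariant : ext2 'cV[R]_2 :=
  \sum_(t : ts_triangle S) wedge (ts_side t 0) (ts_side t 1).

Definition SAF (v : 'cV[R]_2) : ext2 R^o := ext2_map (oproj v) J_invariant.

Definition algebraically_periodic (v : 'cV[R]_2) : Prop := SAF v = 0.

(* Besides a side of [t], the pair [(t, i)] denotes the corner of [t] at the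
   initial point of that side.  The side [s] thus runs from the corner [s] to
   the corner [next_corner s]. *)
Definition next_corner (s : ts_triangle S * 'I_3) : ts_triangle S * 'I_3 :=
  (s.1, s.2 + 1).

(* The next corner, clockwise, around the same vertex of the surface: a vertex
   is an orbit of [turn]. *)
Definition turn (s : ts_triangle S * 'I_3) : ts_triangle S * 'I_3 :=
  next_corner (ts_glue s).

Definition same_vertex (s s' : ts_triangle S * 'I_3) : bool := fconnect turn s s'.

Definition corner_angle (s : ts_triangle S * 'I_3) : R :=
  angle (ts_side s.1 s.2) (- ts_side s.1 (s.2 - 1)).

Definition cone_angle (s : ts_triangle S * 'I_3) : R :=
  \sum_(s' | same_vertex s s') corner_angle s'.

Definition singular (s : ts_triangle S * 'I_3) : Prop := cone_angle s <> 2 * pi.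

(* A rational 1-chain is a formal combination of oriented sides.  Its boundary
   is given by its coefficient at the vertex of each corner. *)
Definition boundary (c : {ffun ts_triangle S * 'I_3 -> rat})
    (s : ts_triangle S * 'I_3) : rat :=
  \sum_(s' | same_vertex s (next_corner s')) c s'
    - \sum_(s' | same_vertex s s') c s'.

(* Cellular cycles of [S] relative to the set of singular points. *)
Definition relative_cycle (c : {ffun ts_triangle S * 'I_3 -> rat}) : Prop :=
  forall s, ~ singular s -> boundary c s = 0.

Definition hol (c : {ffun ts_triangle S * 'I_3 -> rat}) : 'cV[R]_2 :=
  \sum_s ratr (c s) *: ts_side s.1 s.2.

(* The image of [hol] on the relative homology.  Replacing a side by the
   opposite of the glued side, or adding the boundary of a triangle, leaves
   [hol] unchanged, so this is its image on the relative cycles. *)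
Definition holonomy : set 'cV[R]_2 :=
  [set h | exists2 c, relative_cycle c & h = hol c]%classic.

(* [v] is a vector in the direction of a non-zero vector of the holonomy. *)
Definition homological_direction (v : 'cV[R]_2) : Prop :=
  exists h, [/\ holonomy h, h != 0 & exists2 a : R, 0 < a & v = a *: h].

Definition completely_algebraically_periodic : Prop :=
  forall v, homological_direction v -> algebraically_periodic v.

End Invariants.

Record triangle (R : realType) := Triangle {
  tvertex :> 'I_3 -> 'cV[R]_2;
  tvertex_nondegenerate :
    cross (tvertex 1 - tvertex 0) (tvertex 2 - tvertex 1) != 0
}.

Section Triangle.
Variables (R : realType) (P : triangle R).

Definition tside (i : 'I_3) : 'cV[R]_2 := P (i + 1) - P i.

Definition tangle (i : 'I_3) : R := angle (P (i + 1) - P i) (P (i - 1) - P i).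

Definition rational_triangle : Prop :=
  forall i, exists q : rat, tangle i = ratr q * pi.

Definition side_reflection (i : 'I_3) : 'M[R]_2 := reflection (tside i).

(* The subgroup of O(2) generated by the reflections in the sides. *)
Inductive reflection_group : 'M[R]_2 -> Prop :=
| ReflGroup_one : reflection_group 1%:M
| ReflGroup_gen (i : 'I_3) : reflection_group (side_reflection i)
| ReflGroup_mul g h :
    reflection_group g -> reflection_group h -> reflection_group (g *m h)
| ReflGroup_inv g : reflection_group g -> reflection_group (invmx g).

End Triangle.

Section RotationReflection.
Variable R : realType.
Implicit Types (a b c d x y : R) (u w : 'cV[R]_2).

Definition rotmx a b : 'M[R]_2 :=
  \matrix_(i, j) if i == 0 then (if j == 0 then a else - b)
                 else (if j == 0 then b else a).
Definition refmx a b : 'M[R]_2 :=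
  \matrix_(i, j) if i == 0 then (if j == 0 then a else b)
                 else (if j == 0 then b else - a).

Lemma matrix2P (A B : 'M[R]_2) :
  A 0 0 = B 0 0 -> A 0 1 = B 0 1 -> A 1 0 = B 1 0 -> A 1 1 = B 1 1 -> A = B.
Proof.
move=> h00 h01 h10 h11.
have ord2 (i : 'I_2) : i = 0 \/ i = 1.
  by case: i => [[|[|//]] hi]; [left|right]; apply/val_inj.
by apply/matrixP => i j; case: (ord2 i) => ->; case: (ord2 j) => ->.
Qed.

Lemma mulmx2E (m : nat) (A : 'M[R]_2) (B : 'M[R]_(2, m)) i j :
  (A *m B) i j = A i 0 * B 0 j + A i 1 * B 1 j.
Proof.
rewrite mxE big_ord_recl big_ord1; congr (_ + A i _ * B _ j); exact/val_inj.
Qed.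

Lemma dotE u w : dot u w = u 0 0 * w 0 0 + u 1 0 * w 1 0.
Proof.
by rewrite /dot big_ord_recl big_ord1; congr (_ + u _ 0 * w _ 0); apply/val_inj.
Qed.

Lemma dot_eq0 u : (dot u u == 0) = (u == 0).
Proof.
apply/idP/eqP => [|->]; last by rewrite dotE !mxE !mul0r addr0.
rewrite dotE paddr_eq0 ?mulf_eq0 ?orbb; [|by rewrite -expr2 sqr_ge0..].
move=> /andP[/eqP u0 /eqP u1]; apply/matrixP => i j; rewrite !mxE !ord1.
by case: i => [[|[|//]] hi]; [rewrite -[RHS]u0|rewrite -[RHS]u1];
  congr (u _ _); apply/val_inj.
Qed.

Lemma dot_ge0 u : 0 <= dot u u.
Proof. by rewrite dotE -!expr2 addr_ge0 // sqr_ge0. Qed.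

Lemma dot_gt0 u : u != 0 -> 0 < dot u u.
Proof. by rewrite lt_def dot_eq0 dot_ge0 andbT. Qed.

Definition rotm x := rotmx (cos x) (sin x).
Definition refm x := refmx (cos x) (sin x).

Ltac mx2 := apply: matrix2P; rewrite ?mulmx2E !mxE /= ?(cosD, sinD, cosN, sinN);
  ring.

Lemma rot_rot x y : rotm x *m rotm y = rotm (x + y). Proof. by mx2. Qed.
Lemma ref_ref x y : refm x *m refm y = rotm (x - y). Proof. by mx2. Qed.
Lemma rot_ref x y : rotm x *m refm y = refm (x + y). Proof. by mx2. Qed.
Lemma ref_rot x y : refm x *m rotm y = refm (x - y). Proof. by mx2. Qed.

Lemma rot0 : rotm 0 = 1%:M.
Proof. by rewrite /rotm cos0 sin0; apply: matrix2P; rewrite !mxE /= ?oppr0. Qed.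

Lemma mulmx1_invmx (A B : 'M[R]_2) : A *m B = 1%:M -> invmx A = B.
Proof.
move=> AB; have [Au _] := mulmx1_unit AB.
by rewrite -[LHS]mulmx1 -AB mulmxA mulVmx // mul1mx.
Qed.

Lemma invmx_rot x : invmx (rotm x) = rotm (- x).
Proof. by apply: mulmx1_invmx; rewrite rot_rot subrr rot0. Qed.

Lemma invmx_ref x : invmx (refm x) = refm x.
Proof. by apply: mulmx1_invmx; rewrite ref_ref subrr rot0. Qed.

Lemma reflectionE u : u != 0 ->
  reflection u = refmx ((u 0 0 ^+ 2 - u 1 0 ^+ 2) / dot u u)
                       (2 * u 0 0 * u 1 0 / dot u u).
Proof.
rewrite -dot_eq0 dotE => u0.
by apply: matrix2P; rewrite !mxE !big_ord1 !mxE /= ?dotE; field.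
Qed.

Lemma reflectionN u : reflection (- u) = reflection u.
Proof.
rewrite /reflection; congr (_ *: _ - _).
  by congr (2 / _); rewrite !dotE !mxE; ring.
by rewrite raddfN /= mulmxN mulNmx opprK.
Qed.

Lemma reflectionV u : u != 0 -> reflection u *m reflection u = 1%:M.
Proof.
move=> u0; rewrite reflectionE //; move: u0; rewrite -dot_eq0 dotE => u0.
by apply: matrix2P; rewrite mulmx2E !mxE /= ?dotE; field.
Qed.

Lemma reflection_fix u : u != 0 -> reflection u *m u = u.
Proof.
move=> u0; rewrite reflectionE //; move: u0; rewrite -dot_eq0 dotE => u0.
apply/matrixP => i j; rewrite mulmx2E !mxE ord1 /= ?dotE.
by case: i => [[|[|//]] hi] /=; [rewrite (_ : Ordinal hi = 0)|
  rewrite (_ : Ordinal hi = 1)]; try (by apply/val_inj); field.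
Qed.

Lemma sqr_sum1_bound a b : a ^+ 2 + b ^+ 2 = 1 -> -1 <= a <= 1.
Proof.
move=> ab; rewrite -ler_norml -(@expr_le1 _ 2) // real_normK ?num_real //.
by rewrite -ab lerDl sqr_ge0.
Qed.

Lemma polar a b : a ^+ 2 + b ^+ 2 = 1 -> exists x, cos x = a /\ sin x = b.
Proof.
move=> ab; have a1 := sqr_sum1_bound ab.
have ca : cos (acos a) = a by rewrite acosK // in_itv.
have sa : sin (acos a) = `|b|.
  by rewrite sin_acos // -ab addrC addKr sqrtr_sqr.
have [b0|b0] := leP 0 b.
  by exists (acos a); rewrite ca sa ger0_norm.
by exists (- acos a); rewrite cosN sinN ca sa ltr0_norm // opprK.
Qed.

Lemma reflection_ref u : u != 0 -> exists x, reflection u = refm x.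
Proof.
move=> u0; rewrite reflectionE //; move: u0; rewrite -dot_eq0 dotE => u0.
have [|x [cx sx]] := @polar ((u 0 0 ^+ 2 - u 1 0 ^+ 2) / dot u u)
                            (2 * u 0 0 * u 1 0 / dot u u).
  by rewrite dotE; field.
by exists x; rewrite /refm cx sx dotE.
Qed.

Lemma reflection_mul u w : u != 0 -> w != 0 -> exists s : bool,
  reflection u *m reflection w = rotm ((-1) ^+ s * (angle u w *+ 2)).
Proof.
move=> u0 w0; set n := enorm u * enorm w.
have n0 : n != 0.
  by rewrite mulf_neq0 // sqrtr_eq0 -ltNge dot_gt0.
have n2 : n ^+ 2 = dot u u * dot w w.
  by rewrite exprMn !sqr_sqrtr // dot_ge0.
have tc : (dot u w / n) ^+ 2 + (cross u w / n) ^+ 2 = 1.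
  rewrite !expr_div_n -mulrDl n2.
  move: u0 w0; rewrite -!dot_eq0 !dotE /cross => u0 w0; field.
  by rewrite u0 w0.
have t1 := sqr_sum1_bound tc.
have ca : cos (angle u w) = dot u w / n by rewrite acosK // in_itv.
have sa : sin (angle u w) = `|cross u w / n|.
  by rewrite sin_acos // -tc addrC addKr sqrtr_sqr.
exists (0 <= cross u w / n).
have -> : rotm ((-1) ^+ (0 <= cross u w / n)%R * (angle u w *+ 2)) =
    rotmx ((dot u w / n) ^+ 2 *+ 2 - 1)
          (- ((dot u w / n) * (cross u w / n)) *+ 2).
  case: leP => h; rewrite ?mulN1r ?mul1r /rotm ?cosN ?sinN cos_mulr2n sin_mulr2n.
    by rewrite ca sa ger0_norm // mulNrn.
  by rewrite ca sa ltr0_norm // mulrN.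
have -> : dot u w / n * (cross u w / n) = dot u w * cross u w / (dot u u * dot w w).
  by rewrite -n2; field.
rewrite expr_div_n n2 !reflectionE //.
move: u0 w0; rewrite -!dot_eq0 !dotE /cross => u0 w0.
by apply: matrix2P; rewrite mulmx2E !mxE /= ?dotE; field; rewrite u0 w0.
Qed.

Lemma rotD2pi x (m : int) : rotm (x + m%:~R * (pi *+ 2)) = rotm x.
Proof.
have nat_case n y : rotm (y + n%:R * (pi *+ 2)) = rotm y.
  by rewrite /rotm mulr_natl !periodicn //; [exact: sinD2pi|exact: cosD2pi].
case: m => n; first exact: nat_case.
have := nat_case n.+1 (x - n.+1%:R * (pi *+ 2)); rewrite subrK => ->.
by rewrite NegzE mulrNz mulNr.
Qed.

Lemma refD2pi x (m : int) : refm (x + m%:~R * (pi *+ 2)) = refm x.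
Proof.
have refE y : refm y = rotm y *m refm 0 by rewrite rot_ref addr0.
by rewrite refE rotD2pi -refE.
Qed.

End RotationReflection.

Section ReflectionGroupFinite.
Variables (R : realType) (P : triangle R).
Hypothesis hP : rational_triangle P.

Fact ord3E :
  prod (((0 + 1 : 'I_3)%R = 1%R) * ((1 + 1 : 'I_3)%R = 2%R) * ((2 + 1 : 'I_3)%R = 0%R))%type
       (((0 - 1 : 'I_3)%R = 2%R) * ((1 - 1 : 'I_3)%R = 0%R) * ((2 - 1 : 'I_3)%R = 1%R))%type.
Proof. by do ![split]; apply/val_inj. Qed.

Lemma tside_sum : \sum_i tside P i = 0.
Proof.
rewrite /tside big_split /= sumrN; apply/eqP; rewrite subr_eq0; apply/eqP.
by rewrite [RHS](reindex_inj (addIr (1 : 'I_3))).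
Qed.

Lemma tside_cross_neq0 : cross (tside P 0) (tside P 1) != 0.
Proof.
by have := tvertex_nondegenerate P; rewrite /tside !ord3E.
Qed.

Lemma ord3P (Q : 'I_3 -> Prop) : Q 0 -> Q 1 -> Q 2 -> forall i, Q i.
Proof.
move=> h0 h1 h2 [[|[|[|//]]] hi].
- by rewrite (_ : Ordinal hi = 0) //; apply/val_inj.
- by rewrite (_ : Ordinal hi = 1) //; apply/val_inj.
- by rewrite (_ : Ordinal hi = 2) //; apply/val_inj.
Qed.

Lemma sum3E (V : zmodType) (f : 'I_3 -> V) : \sum_i f i = f 0 + f 1 + f 2.
Proof.
rewrite !big_ord_recl big_ord0 addr0 addrA.
by congr (_ + f _ + f _); apply/val_inj.
Qed.

Lemma tside2 : tside P 2 = - (tside P 0 + tside P 1).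
Proof. by apply/eqP; rewrite -addr_eq0 addrC -sum3E tside_sum. Qed.

Lemma tside_neq0 i : tside P i != 0.
Proof.
have := tside_cross_neq0; apply: contraNneq; move: i; apply: ord3P => h.
- by rewrite h /cross !mxE !mul0r subrr.
- by rewrite h /cross !mxE !mulr0 subrr.
- have -> : tside P 1 = - tside P 0.
    by apply/eqP; rewrite -addr_eq0 addrC -oppr_eq0 -tside2 h.
  by rewrite /cross !mxE mulrN mulrN opprK mulrC addNr.
Qed.

Let step (N : nat) (k : int) : R := k%:~R * (pi *+ 2 / N%:R).

Lemma reflection_group_dihedral : exists (N : nat) (t : R), (0 < N)%N /\
  forall g, reflection_group P g ->
    exists k : int, g = rotm (step N k) \/ g = refm (t + step N k).
Proof.
have [q0 h0] := hP 0; have [q1 h1] := hP 1.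
pose N := (`|denq q0| * `|denq q1|)%N.
have N0 : (0 < N)%N by rewrite muln_gt0 !absz_gt0 !denq_neq0.
have stepE (q : rat) (d : int) : d != 0 -> (N%:Z = denq q * d)%R ->
    ratr q * pi *+ 2 = step N (numq q * d) :> R.
  move=> d0 NE; rewrite /step (_ : N%:R = N%:Z%:~R :> R) // NE -[q in LHS]divq_num_den.
  rewrite fmorph_div !rmorph_int !rmorphM /=; field.
  by rewrite !intr_eq0 d0 denq_neq0.
have NE : N%:Z = denq q0 * denq q1 by rewrite PoszM !gez0_abs // denq_ge0.
have {}h0 : tangle P 0 *+ 2 = step N (numq q0 * denq q1).
  by rewrite h0 (stepE q0 (denq q1)) // denq_neq0.
have {}h1 : tangle P 1 *+ 2 = step N (numq q1 * denq q0).
  by rewrite h1 (stepE q1 (denq q0)) ?denq_neq0 // mulrC.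
have stepD k l : step N (k + l) = step N k + step N l.
  by rewrite /step intrD mulrDl.
have stepN k : step N (- k) = - step N k by rewrite /step mulrNz mulNr.
have stepS (s : bool) k : (-1) ^+ s * step N k = step N ((-1) ^+ s * k).
  by case: s; rewrite ?mulN1r ?mul1r ?stepN.
have [t rt] := reflection_ref (tside_neq0 0).
have r1 : exists k, side_reflection P 1 = refm (t + step N k).
  have [|s hs] := reflection_mul (tside_neq0 1) (w := - tside P 0).
    by rewrite oppr_eq0 tside_neq0.
  exists ((-1) ^+ s * (numq q1 * denq q0)).
  rewrite -stepS -h1 [t + _]addrC -rot_ref -rt.
  have -> : tangle P 1 = angle (tside P 1) (- tside P 0).
    by rewrite /tangle /tside opprB !ord3E.
  by rewrite -hs reflectionN -mulmxA reflectionV ?tside_neq0 // mulmx1.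
have r2 : exists k, side_reflection P 2 = refm (t + step N k).
  have [|s hs] := reflection_mul (tside_neq0 0) (w := - tside P 2).
    by rewrite oppr_eq0 tside_neq0.
  exists (- ((-1) ^+ s * (numq q0 * denq q1))).
  rewrite stepN -stepS -h0 -ref_rot -rt.
  have -> : tangle P 0 = angle (tside P 0) (- tside P 2).
    by rewrite /tangle /tside opprB !ord3E.
  by rewrite -hs reflectionN mulmxA reflectionV ?tside_neq0 // mul1mx.
have step0 : step N 0 = 0 by rewrite /step mul0r.
exists N, t; split=> // g; elim=> {g} [|i|g h _ [k hk] _ [l hl]|g _ [k hk]].
- by exists 0; left; rewrite step0 rot0.
- move: i; apply: ord3P; first by exists 0; right; rewrite step0 addr0 -rt.
    by have [k hk] := r1; exists k; right.
  by have [k hk] := r2; exists k; right.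
- case: hk hl => -> [] ->.
  + by exists (k + l); left; rewrite rot_rot stepD.
  + by exists (k + l); right; rewrite rot_ref stepD addrCA.
  + by exists (k - l); right; rewrite ref_rot stepD stepN addrA.
  + by exists (k - l); left; rewrite ref_ref stepD stepN opprD addrACA subrr add0r.
- case: hk => ->.
  + by exists (- k); left; rewrite invmx_rot stepN.
  + by exists k; right; rewrite invmx_ref.
Qed.

Lemma reflection_group_finite : finite_set (reflection_group P).
Proof.
have [N [t [N0 hN]]] := reflection_group_dihedral.
have stepE k : exists (r : 'I_N) (m : int),
    step N k = step N (r : nat) + m%:~R * (pi *+ 2).
  have Nz : N%:Z != 0 by rewrite eqz_nat -lt0n.
  have rN : (`|(k %% N)%Z| < N)%N.
    by rewrite -ltz_nat gez0_abs ?modz_ge0 // ltz_mod.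
  exists (Ordinal rN), (k %/ N)%Z; rewrite /step /= gez0_abs ?modz_ge0 //.
  rewrite [in LHS](divz_eq k N) intrD intrM addrC; field.
  by rewrite pnatr_eq0 -lt0n.
pose f (x : 'I_N * bool) : 'M[R]_2 :=
  if x.2 then refm (t + step N (x.1 : nat)) else rotm (step N (x.1 : nat)).
apply: (@sub_finite_set _ _ (f @` setT)%classic); last first.
  exact/finite_image/finite_finset.
move=> g /hN [k hk]; have [r [m hr]] := stepE k; case: hk => ->.
- by exists (r, false) => //; rewrite /f /= hr rotD2pi.
- by exists (r, true) => //; rewrite /f /= hr addrA refD2pi.
Qed.

End ReflectionGroupFinite.

Section Unfolding.
Variables (R : realType) (P : triangle R).
Hypothesis hP : rational_triangle P.

(* The reflection group is finite by [reflection_group_finite], so that this is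
   the type of its elements: see [in_unfold_group]. *)
Definition unfold_group : {fset 'M[R]_2} := fset_set (reflection_group P).

Lemma in_unfold_group g : g \in unfold_group <-> reflection_group P g.
Proof.
by rewrite in_fset_set; [rewrite inE|exact: reflection_group_finite].
Qed.

Lemma reflection_group_unit g : reflection_group P g -> g \in unitmx.
Proof.
elim=> {g} [|i|g h _ gu _ hu|g _ gu].
- exact: unitmx1.
- by have /mulmx1_unit[] := reflectionV (tside_neq0 P i).
- by rewrite unitmx_mul gu.
- by rewrite unitmx_inv.
Qed.

Lemma det2E (A : 'M[R]_2) : \det A = A 0 0 * A 1 1 - A 0 1 * A 1 0.
Proof.
rewrite (expand_det_row A 0) big_ord_recl big_ord1 /cofactor !det_mx11 !mxE.
rewrite /= /bump /= expr0 expr1 mul1r mulN1r mulrN.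
congr (_ * A _ _ - A _ _ * A _ _); exact/val_inj.
Qed.

Lemma cross_mulmx (g : 'M[R]_2) u w : cross (g *m u) (g *m w) = \det g * cross u w.
Proof. rewrite det2E /cross !mulmx2E; ring. Qed.

Lemma det_side_reflection i : \det (side_reflection P i) = -1.
Proof.
rewrite /side_reflection; move: (tside P i) (tside_neq0 P i) => u u0.
rewrite reflectionE //; move: u0; rewrite -dot_eq0 dotE => u0.
by rewrite det2E !mxE /=; field.
Qed.

(* Whether the copy [gP], with its sides labelled as those of [P], is traversed
   clockwise. *)
Definition flipped (g : 'M[R]_2) : bool :=
  cross (g *m tside P 0) (g *m tside P 1) < 0.

Lemma flipped_mul g i : reflection_group P g ->
  flipped (g *m side_reflection P i) = ~~ flipped g.
Proof.
move=> /reflection_group_unit; rewrite unitmxE unitfE => gu; rewrite /flipped !cross_mulmx det_mulmx.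
rewrite det_side_reflection mulrN1 mulNr oppr_lt0 -leNgt le_eqVlt.
by rewrite eq_sym mulf_eq0 (negPf gu) (negPf (tside_cross_neq0 P)).
Qed.

(* The [i]-th side of the copy [gP] in counterclockwise order is the image of
   the side of [P] with the following label. *)
Definition side_label (g : 'M[R]_2) (i : 'I_3) : 'I_3 :=
  if flipped g then rev_ord i else i.

Definition unfold_side (g : unfold_group) (i : 'I_3) : 'cV[R]_2 :=
  (-1) ^+ flipped (val g) *: (val g *m tside P (side_label (val g) i)).

Fact unfold_mul_subproof (g : unfold_group) i :
  val g *m side_reflection P i \in unfold_group.
Proof.
apply/in_unfold_group; apply: ReflGroup_mul (ReflGroup_gen _ _).
exact/in_unfold_group/valP.
Qed.

Definition unfold_mul (g : unfold_group) (i : 'I_3) : unfold_group :=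
  [` unfold_mul_subproof g i]%fset.

(* The side of [gP] with label [e] is glued to the side of [g r_e P] with the
   same label.  As [g] and [g r_e] have opposite orientations, the position of
   that label in counterclockwise order is reversed. *)
Definition unfold_glue (s : unfold_group * 'I_3) : unfold_group * 'I_3 :=
  (unfold_mul s.1 (side_label (val s.1) s.2), rev_ord s.2).

Lemma unfold_group_refl (g : unfold_group) : reflection_group P (val g).
Proof. exact/in_unfold_group/valP. Qed.

Lemma unfold_glue_label s :
  side_label (val (unfold_glue s).1) (unfold_glue s).2 =
  side_label (val s.1) s.2.
Proof.
rewrite /side_label /= flipped_mul; last exact: unfold_group_refl.
by case: flipped; rewrite ?rev_ordK.
Qed.

Fact unfold_side_sum g : \sum_i unfold_side g i = 0.
Proof.
rewrite -scaler_sumr -mulmx_sumr.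
have -> : \sum_i tside P (side_label (val g) i) = \sum_i tside P i.
  rewrite /side_label; case: flipped => //.
  by rewrite [RHS](reindex_inj rev_ord_inj).
by rewrite tside_sum mulmx0 scaler0.
Qed.

Fact unfold_side_ccw g : 0 < cross (unfold_side g 0) (unfold_side g 1).
Proof.
have := reflection_group_unit (unfold_group_refl g).
rewrite unitmxE unitfE => gu.
have cZ (b : bool) u w : cross ((-1) ^+ b *: u) ((-1) ^+ b *: w) = cross u w.
  by case: b; rewrite /cross !mxE; ring.
rewrite /unfold_side /side_label cZ; case: ifPn => h.
  have -> : rev_ord (0 : 'I_3) = 2 by apply/val_inj.
  have -> : rev_ord (1 : 'I_3) = 1 by apply/val_inj.
  move: h; rewrite /flipped !cross_mulmx tside2.
  have -> : cross (- (tside P 0 + tside P 1)) (tside P 1) =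
            - cross (tside P 0) (tside P 1) by rewrite /cross !mxE; ring.
  by rewrite mulrN oppr_gt0.
move: h; rewrite /flipped -leNgt le_eqVlt => /orP[|//].
by rewrite eq_sym cross_mulmx mulf_eq0 (negPf gu) (negPf (tside_cross_neq0 P)).
Qed.

Fact unfold_glueK : involutive unfold_glue.
Proof.
move=> s; have := unfold_glue_label s; case: s => g i /= h.
rewrite /unfold_glue /= {}h; congr (_, _); last exact: rev_ordK.
by apply/val_inj; rewrite /= -mulmxA reflectionV ?tside_neq0 // mulmx1.
Qed.

Fact unfold_glue_side s :
  unfold_side (unfold_glue s).1 (unfold_glue s).2 = - unfold_side s.1 s.2.
Proof.
rewrite /unfold_side unfold_glue_label /= flipped_mul; last first.
  exact: unfold_group_refl.
rewrite -mulmxA reflection_fix ?tside_neq0 //.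
by case: flipped; rewrite ?scaleN1r ?scale1r ?opprK.
Qed.

Fact unfold_inhabited : (0 < #|{: unfold_group}|)%N.
Proof.
by apply/card_gt0P; exists [` (in_unfold_group _).2 (ReflGroup_one P)]%fset.
Qed.

Fact unfold_connected (g g' : unfold_group) :
  connect (fun a b => [exists i, (unfold_glue (a, i)).1 == b]) g g'.
Proof.
set e := fun _ _ => _.
have e_sym : connect_sym e.
  have e1 a b : e a b -> e b a.
    move=> /existsP[i /eqP <-]; apply/existsP; exists (unfold_glue (a, i)).2.
    by rewrite -surjective_pairing unfold_glueK.
  by apply: sym_connect_sym => a b; apply/idP/idP; exact: e1.
have gen (h : 'M[R]_2) : reflection_group P h ->
    forall a b : unfold_group, val b = val a *m h -> connect e a b.
  elim=> {h} [|i|h k hh IHh hk IHk|h hh IH] a b ab.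
  - by rewrite (_ : b = a) //; apply/val_inj; rewrite ab mulmx1.
  - apply/connect1/existsP; exists (side_label (val a) i); apply/eqP/val_inj.
    by rewrite /= ab /side_label; case: flipped; rewrite ?rev_ordK.
  - have ch : val a *m h \in unfold_group.
      by apply/in_unfold_group/ReflGroup_mul => //; exact: unfold_group_refl.
    apply: (connect_trans (IHh a [` ch]%fset _)) => //.
    by apply: IHk; rewrite ab mulmxA.
  - rewrite e_sym; apply: IH; rewrite ab -mulmxA mulVmx ?mulmx1 //.
    exact: reflection_group_unit.
apply: (gen (invmx (val g) *m val g')).
  by apply: ReflGroup_mul; [apply: ReflGroup_inv|]; apply: unfold_group_refl.
by rewrite mulmxA mulmxV ?mul1mx // reflection_group_unit //;
  apply: unfold_group_refl.
Qed.

Definition unfolding : translation_surface R :=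
  @TranslationSurface R unfold_group unfold_side unfold_glue unfold_side_sum
    unfold_side_ccw unfold_glueK unfold_glue_side unfold_inhabited
    unfold_connected.

End Unfolding.

(* Main.v *)
(** Let [H] be the abelian group of rotations in the reflection group [G], and
    [e_0], [e_1], [e_2] the sides of the triangle.  Every holonomy vector lies
    in the Q-span [L] of the orbit [H e_0]: this span is stable under [G], as
    [e_0] is fixed by a reflection, and it contains [e_1], because the
    relation [e_0 + e_1 + e_2 = 0] expresses [e_1] through [e_0] by means of
    rotations and of the inverse of [1 - r_2 r_1], a rational polynomial in the
    rotation of finite order [r_2 r_1].  For [v], [x], [y] in [L] the functions
    [g |-> v * g x] and [g |-> v * g y] on [H], where [*] is the cross product,
    are Q-combinations of translates of [f g = e_0 * g e_0], which is odd:
    [f (g^-1) = - f g].  Since [g |-> (h k g)^-1] exchanges [f (h g)] and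
    [f (k g)] up to sign, [\sum_g f (h g) /\ f (k g)] is its own opposite,
    hence 0.  The SAF invariant is the sum of two such sums, one for the
    rotations and one for the reflections of [G]. *)

Require Import Defs.
From HB Require Import structures.
From mathcomp Require Import all_boot all_order all_algebra reals.
From mathcomp Require Import fingroup finmap freeg boolp trigo ring.
Set Implicit Arguments.
Unset Strict Implicit.
Unset Printing Implicit Defensive.
Import Order.TTheory GRing.Theory Num.Theory.
Local Open Scope ring_scope.
Local Open Scope quotient_scope.

(** * Rational bilinearity of the wedge *)

Section Wedge.
Variables (F : numFieldType) (V : lmodType F).
Implicit Types u w : V.

Lemma pi_ext2B (x y : {freeg (V * V) / rat}) :
  \pi_(ext2 V) (x - y) = \pi_(ext2 V) x - \pi_(ext2 V) y.
Proof. by rewrite !piE. Qed.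

Lemma pi_ext2D (x y : {freeg (V * V) / rat}) :
  \pi_(ext2 V) (x + y) = \pi_(ext2 V) x + \pi_(ext2 V) y.
Proof. by rewrite !piE. Qed.

Lemma pi_ext2_eq0 (x : {freeg (V * V) / rat}) :
  ext2_relation x -> \pi_(ext2 V) x = 0.
Proof.
move=> hx; rewrite -[0](subrr (\pi_(ext2 V) 0)) -pi_ext2B subrr.
by apply/eqP; rewrite -Quotient.idealrBE subr0; apply/asboolP.
Qed.

Lemma pi_ext2_eq (x y : {freeg (V * V) / rat}) :
  ext2_relation (x - y) -> \pi_(ext2 V) x = \pi_(ext2 V) y.
Proof. by move=> /pi_ext2_eq0; rewrite pi_ext2B => /subr0_eq. Qed.

Lemma wedgeDl u u' w : wedge (u + u') w = wedge u w + wedge u' w.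
Proof.
rewrite /wedge -pi_ext2D; apply: pi_ext2_eq.
by have := Ext2_linl 1 u u' w; rewrite rmorph1 !scale1r.
Qed.

Lemma wedgeDr u w w' : wedge u (w + w') = wedge u w + wedge u w'.
Proof.
rewrite /wedge -pi_ext2D; apply: pi_ext2_eq.
by have := Ext2_linr 1 u w w'; rewrite rmorph1 !scale1r.
Qed.

Lemma wedge0l w : wedge 0 w = 0.
Proof. by apply: (addrI (wedge 0 w)); rewrite -wedgeDl !addr0. Qed.

Lemma wedge0r u : wedge u 0 = 0.
Proof. by apply: (addrI (wedge u 0)); rewrite -wedgeDr !addr0. Qed.

Lemma wedgeNl u w : wedge (- u) w = - wedge u w.
Proof. by apply/eqP; rewrite -addr_eq0 -wedgeDl addNr wedge0l. Qed.

Lemma wedgeNr u w : wedge u (- w) = - wedge u w.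
Proof. by apply/eqP; rewrite -addr_eq0 -wedgeDr addNr wedge0r. Qed.

Lemma wedge_id u : wedge u u = 0.
Proof. exact/pi_ext2_eq0/Ext2_alt. Qed.

Lemma wedgeC u w : wedge u w = - wedge w u.
Proof.
apply/eqP; rewrite -addr_eq0; have := wedge_id (u + w).
by rewrite wedgeDl !wedgeDr !wedge_id add0r addr0 => ->.
Qed.

(** [ext2] carries only an additive group structure here, so a rational scalar is moved from one
    factor to the other instead of being pulled out. *)
Lemma wedgeZ (a : rat) u w : wedge (ratr a *: u) w = wedge u (ratr a *: w).
Proof.
have zl : \pi_(ext2 V) << ((0 : V), w) >> = 0 := wedge0l w.
have zr : \pi_(ext2 V) << (u, (0 : V)) >> = 0 := wedge0r u.
have /pi_ext2_eq := Ext2_linl a u 0 w; rewrite pi_ext2D zl !addr0.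
by have /pi_ext2_eq := Ext2_linr a u w 0; rewrite pi_ext2D zr !addr0 => <-.
Qed.

Lemma wedge_suml I (r : seq I) (p : pred I) (f : I -> V) w :
  wedge (\sum_(i <- r | p i) f i) w = \sum_(i <- r | p i) wedge (f i) w.
Proof. elim/big_rec2: _ => [|i x y _ <-]; [exact: wedge0l|exact: wedgeDl]. Qed.

Lemma wedge_sumr I (r : seq I) (p : pred I) (f : I -> V) u :
  wedge u (\sum_(i <- r | p i) f i) = \sum_(i <- r | p i) wedge u (f i).
Proof. elim/big_rec2: _ => [|i x y _ <-]; [exact: wedge0r|exact: wedgeDr]. Qed.

(** * Odd functions on a finite abelian group *)

Section OddFunction.
Variables (gT : finGroupType) (H : {group gT}) (f : gT -> V).
Hypotheses (abelH : abelian H) (oddf : {in H, forall x, f x^-1%g = - f x}).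

Lemma sum_wedge_odd_translates (a b : rat) h k : h \in H -> k \in H ->
  \sum_(g in H) wedge (ratr a *: f (h * g)%g) (ratr b *: f (k * g)%g) = 0.
Proof.
move=> hH kH.
have cancel_inv x y : x \in H -> y \in H -> (x * (x * y)^-1 = y^-1)%g.
  by move=> xH yH; rewrite (centsP abelH x xH y yH) invMg mulKVg.
(* [g |-> (h k g)^-1] exchanges [h g] and [k g] up to inversion. *)
have anti c : \sum_(g in H) wedge (ratr c *: f (h * g)%g) (ratr b *: f (k * g)%g)
    = - \sum_(g in H) wedge (ratr c *: f (h * g)%g) (ratr b *: f (k * g)%g).
  have inj : injective (fun g : gT => (h * k * g)^-1%g).
    by move=> x y /invg_inj/mulgI.
  rewrite [LHS](reindex_inj inj) /= -sumrN.
  apply: eq_big => g; first by rewrite groupV !groupMl.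
  rewrite groupV !groupMl // => gH.
  rewrite {2}(centsP abelH h hH k kH) -!mulgA !cancel_inv ?groupMl //.
  rewrite !oddf ?groupMl // !scalerN wedgeNl wedgeNr opprK.
  by rewrite wedgeC !wedgeZ !scalerA mulrC.
(* Being its own opposite does not by itself make a sum vanish in an abelian group. Halving [a]
   yields two equal sums, and [anti] turns one into the opposite of the other. *)
have half : ratr a = ratr (a / 2) + ratr (a / 2) :> F.
  by rewrite -rmorphD /= -splitr.
rewrite half; under eq_bigr do rewrite scalerDl wedgeDl.
by rewrite big_split /= {1}anti addNr.
Qed.

Lemma sum_wedge_odd (c d : gT -> rat) :
  \sum_(g in H) wedge (\sum_(h in H) ratr (c h) *: f (h * g)%g)
                      (\sum_(k in H) ratr (d k) *: f (k * g)%g) = 0.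
Proof.
under eq_bigr => g gH.
  rewrite wedge_suml; under eq_bigr do rewrite wedge_sumr.
  over.
rewrite exchange_big big1 // => h hH /=.
by rewrite exchange_big big1 // => k kH; exact: sum_wedge_odd_translates.
Qed.

End OddFunction.
End Wedge.

(** * Cross products and plane rotations *)

Section CrossAndRotations.
Variable R : realType.

Lemma cross_suml I (r : seq I) (p : pred I) (f : I -> 'cV[R]_2) w :
  cross (\sum_(i <- r | p i) f i) w = \sum_(i <- r | p i) cross (f i) w.
Proof.
elim/big_rec2: _ => [|i x y _ <-]; rewrite /cross !mxE; by ring.
Qed.

Lemma cross_sumr I (r : seq I) (p : pred I) (f : I -> 'cV[R]_2) u :
  cross u (\sum_(i <- r | p i) f i) = \sum_(i <- r | p i) cross u (f i).
Proof.
elim/big_rec2: _ => [|i x y _ <-]; rewrite /cross !mxE; by ring.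
Qed.

Lemma crossZl (a : R) u w : cross (a *: u) w = a * cross u w.
Proof. by rewrite /cross !mxE; ring. Qed.

Lemma crossZr (a : R) u w : cross u (a *: w) = a * cross u w.
Proof. by rewrite /cross !mxE; ring. Qed.

Lemma oppr1_neq1 : (-1 == 1 :> R) = false.
Proof. by rewrite lt_eqF // (lt_trans (ltrN10 R) ltr01). Qed.

Lemma rotm_comm (x y : R) : rotm x *m rotm y = rotm y *m rotm x.
Proof. by rewrite !Defs.rot_rot addrC. Qed.

Lemma det_rotm (x : R) : \det (rotm x) = 1.
Proof. by rewrite det2E !mxE /= mulNr opprK -!expr2 cos2Dsin2. Qed.

Lemma det_refm (x : R) : \det (refm x) = -1.
Proof. by rewrite det2E !mxE /= mulrN -opprD -!expr2 cos2Dsin2. Qed.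

End CrossAndRotations.

(** * The reflection group as a finite group, and its rotations *)

Section UnfoldingGroup.
Variables (R : realType) (P : triangle R) (hP : rational_triangle P).

(* The group law is total only because the angles are rational, hence the
   phantom argument. *)
Definition unfold_gT_of of rational_triangle P : Type := unfold_group P.
Local Notation unfold_gT := (unfold_gT_of hP).
HB.instance Definition _ := Finite.on unfold_gT.
Implicit Types g h : unfold_gT.

Definition umx g : 'M[R]_2 := val (g : unfold_group P).

Lemma umx_inj : injective umx. Proof. exact: val_inj. Qed.

Lemma umxP g : reflection_group P (umx g).
Proof. exact/in_unfold_group/valP. Qed.

Definition ugrp (A : 'M[R]_2) (hA : reflection_group P A) : unfold_gT :=
  [` (in_unfold_group hP A).2 hA]%fset.

Definition umul g h : unfold_gT := ugrp (ReflGroup_mul (umxP g) (umxP h)).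
Definition uone : unfold_gT := ugrp (ReflGroup_one P).
Definition uinv g : unfold_gT := ugrp (ReflGroup_inv (umxP g)).

Fact umulA : associative umul.
Proof. by move=> g h k; apply/umx_inj; exact: mulmxA. Qed.

Fact umul1 : left_id uone umul.
Proof. by move=> g; apply/umx_inj; exact: mul1mx. Qed.

Fact umulV : left_inverse uone uinv umul.
Proof.
move=> g; apply/umx_inj; apply: mulVmx.
exact: reflection_group_unit (umxP g).
Qed.

HB.instance Definition _ := Finite_isGroup.Build unfold_gT umulA umul1 umulV.

Lemma umxM g h : umx (g * h)%g = umx g *m umx h. Proof. by []. Qed.
Lemma umx1 : umx 1%g = 1%:M. Proof. by []. Qed.


Lemma umxX g n : umx (g ^+ n)%g = umx g ^+ n.
Proof.
by elim: n => [|n IH]; rewrite ?expg0 ?expr0 // expgS exprS -IH.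
Qed.

Lemma umx_det_cases g :
  (\det (umx g) = 1 /\ exists x, umx g = rotm x) \/ \det (umx g) = -1.
Proof.
have [N [t [_ dih]]] := reflection_group_dihedral hP.
have [k [->|->]] := dih _ (umxP g).
- by left; rewrite det_rotm; split=> //; eexists.
- by right; rewrite det_refm.
Qed.

Definition rotations : {set unfold_gT} := [set g | \det (umx g) == 1].

Fact rotations_group_set : group_set rotations.
Proof.
apply/group_setP; split; first by rewrite inE umx1 det1.
by move=> g h; rewrite !inE umxM det_mulmx => /eqP -> /eqP ->; rewrite mulr1.
Qed.
Canonical rotations_group := group rotations_group_set.

Lemma det_rotation g : g \in rotations -> \det (umx g) = 1.
Proof. by rewrite inE => /eqP. Qed.

Lemma det_nonrotation g : g \notin rotations -> \det (umx g) = -1.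
Proof. by rewrite inE; case: (umx_det_cases g) => [[->]|//]; rewrite eqxx. Qed.

Lemma rotationP g : g \in rotations -> exists x, umx g = rotm x.
Proof.
move=> /det_rotation d1; case: (umx_det_cases g) => [[]//|].
by rewrite d1 => /esym/eqP; rewrite oppr1_neq1.
Qed.

Lemma rotations_abelian : abelian rotations.
Proof.
apply/centsP => g gH h hH; apply: umx_inj; rewrite !umxM.
by have [x ->] := rotationP gH; have [y ->] := rotationP hH; rewrite rotm_comm.
Qed.

Definition uref i : unfold_gT := ugrp (ReflGroup_gen P i).

Lemma mul_uref_rotation g i : (g * uref i \in rotations)%g = (g \notin rotations).
Proof.
have dE : \det (umx (g * uref i)%g) = - \det (umx g).
  by rewrite umxM det_mulmx det_side_reflection mulrN1.
rewrite [in LHS]inE dE; have [gH|gH] := boolP (g \in rotations).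
- by rewrite (det_rotation gH) oppr1_neq1.
- by rewrite (det_nonrotation gH) opprK eqxx.
Qed.

(** * The rational span of the rotated copies of [e 0] *)

Local Notation e i := (tside P i).

Definition rot_span (x : 'cV[R]_2) : Prop :=
  exists c : unfold_gT -> rat,
    x = \sum_(h in rotations) ratr (c h) *: (umx h *m e 0).

Lemma rot_spanD x y : rot_span x -> rot_span y -> rot_span (x + y).
Proof.
move=> [c ->] [d ->]; exists (fun h => c h + d h).
by rewrite -big_split; apply: eq_bigr => h _; rewrite rmorphD scalerDl.
Qed.

Lemma rot_spanZ (a : rat) x : rot_span x -> rot_span (ratr a *: x).
Proof.
move=> [c ->]; exists (fun h => a * c h).
by rewrite scaler_sumr; apply: eq_bigr => h _; rewrite rmorphM scalerA.
Qed.

Lemma rot_spanN x : rot_span x -> rot_span (- x).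
Proof. by move=> /(rot_spanZ (-1)); rewrite rmorphN1 scaleN1r. Qed.

Lemma rot_span0 : rot_span 0.
Proof. by exists (fun=> 0); rewrite big1 // => h _; rewrite rmorph0 scale0r. Qed.

Lemma rot_span_sum I (r : seq I) (p : pred I) (x : I -> 'cV[R]_2) :
  (forall i, p i -> rot_span (x i)) -> rot_span (\sum_(i <- r | p i) x i).
Proof.
by move=> hx; elim/big_rec: _ => [|i y /hx]; [exact: rot_span0|exact: rot_spanD].
Qed.

Lemma rot_span_tside0 g : rot_span (umx g *m e 0).
Proof.
have rot h : h \in rotations -> rot_span (umx h *m e 0).
  move=> hH; exists (fun k => (k == h)%:R).
  rewrite (bigD1 h) //= eqxx rmorph1 scale1r big1 ?addr0 // => k /andP[_ /negPf ->].
  by rewrite rmorph0 scale0r.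
have [/rot//|gH] := boolP (g \in rotations).
(* As [uref 0] fixes [e 0], a non-rotation [g] can be replaced by the rotation [g * uref 0]. *)
have := rot (g * uref 0%R)%g; rewrite mul_uref_rotation umxM => /(_ gH).
by rewrite -mulmxA reflection_fix ?tside_neq0.
Qed.

Lemma rot_span_mul g x : rot_span x -> rot_span (umx g *m x).
Proof.
move=> [c ->]; rewrite mulmx_sumr; apply: rot_span_sum => h _.
by rewrite -scalemxAr mulmxA -umxM; apply/rot_spanZ/rot_span_tside0.
Qed.

Lemma uref_tside i : umx (uref i) *m e i = e i.
Proof. by rewrite reflection_fix ?tside_neq0. Qed.

Lemma rotation_sub1_unit g : g \in rotations -> g != 1%g ->
  umx g - 1 \is a GRing.unit.
Proof.
move=> gH g1; have [x gx] := rotationP gH.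
rewrite [_ \is a _]unitmxE unitfE; apply: contra g1 => /eqP.
have -> : \det (umx g - 1) = (cos x - 1) ^+ 2 + sin x ^+ 2.
  by rewrite gx det2E !mxE /=; ring.
move=> /eqP; rewrite paddr_eq0 ?sqr_ge0 // !sqrf_eq0 => /andP[/eqP c1 /eqP s0].
apply/eqP/umx_inj; rewrite gx umx1 -Defs.rot0 /rotm cos0 sin0 s0.
by rewrite (subr0_eq c1).
Qed.

(** Otherwise the reflections in sides 1 and 2 coincide, and a map of determinant -1 fixes both
    [e 1] and [e 2]. Their cross product then equals its opposite, against nondegeneracy. *)
Lemma uref_neq : (uref 2%R * uref 1%R != 1)%g.
Proof.
apply/eqP => r1.
have r11 : umx (uref 1%R) *m umx (uref 1%R) = 1%:M.
  exact: reflectionV (tside_neq0 P 1).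
have r21 : umx (uref 2%R) = umx (uref 1%R).
  by rewrite -[LHS]mulmx1 -r11 mulmxA -umxM r1 umx1 mul1mx.
have : cross (e 1) (e 2) = - cross (e 1) (e 2).
  rewrite -[in LHS]uref_tside -[in LHS](uref_tside 2) -r21 cross_mulmx.
  by rewrite det_side_reflection mulN1r.
move=> /eqP; rewrite -addr_eq0 -mulr2n mulrn_eq0 /= => /eqP c0.
have /negP[] := tside_cross_neq0 P; apply/eqP; rewrite -c0 tside2 /cross !mxE.
by ring.
Qed.

(** Summation by parts. When [A ^+ n = 1] and the powers of [A] sum to 0, the right-hand side is the
    scalar [n], which inverts [A - 1] with rational coefficients. *)
Lemma sum_mulrn_expr_sub1 (A : 'M[R]_2) n :
  (\sum_(j < n) j%:R *: A ^+ j) * (A - 1) = n%:R *: A ^+ n - A * \sum_(j < n) A ^+ j.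
Proof.
elim: n => [|n IH]; first by rewrite !big_ord0 mul0r mulr0 scale0r subr0.
rewrite !big_ord_recr /= mulrDl IH !mulrDr mulrN1 -scalerAl -exprSr -exprS.
rewrite -[n.+1%:R]natr1 scalerDl scale1r opprD [RHS]addrACA subrr addr0.
by rewrite [LHS]addrC [LHS]addrA subrK.
Qed.

(* The sides add up to 0 and the reflection [r_i] fixes [e i], so that
   [(r_2 r_1 - 1) e_1 = (1 - r_2 r_0) e_0].  For a rotation [A <> 1] of order
   [n], the inverse of [A - 1] is [1/n * \sum_(j < n) j A^j]. *)
Lemma rot_span_tside1 : rot_span (e 1).
Proof.
pose g := (uref 2%R * uref 1%R)%g; pose n := #[g]%g; pose A := umx g.
have gH : g \in rotations.
  by rewrite mul_uref_rotation inE det_side_reflection oppr1_neq1.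
have A1u : A - 1 \is a GRing.unit := rotation_sub1_unit gH uref_neq.
have An : A ^+ n = 1 by rewrite -umxX expg_order.
have sumA : \sum_(j < n) A ^+ j = 0.
  by apply: (mulrI A1u); rewrite -subrX1 An subrr mulr0.
have n0 : n%:R != 0 :> R by rewrite pnatr_eq0 -lt0n order_gt0.
pose y := (A - 1) *m e 1.
have yE : y = e 0 - umx (uref 2%R * uref 0%R)%g *m e 0.
  rewrite /y mulmxBl mul1mx /A /g !umxM -!mulmxA !uref_tside.
  have := uref_tside 2; rewrite tside2 mulmxN mulmxDr => /oppr_inj h2.
  by apply/eqP; rewrite subr_eq addrAC eq_sym subr_eq -h2 addrC.
have ny : n%:R *: e 1 = \sum_(j < n) j%:R *: (A ^+ j *m y).
  under eq_bigr do rewrite scalemxAl; rewrite -mulmx_suml /y mulmxA.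
  have -> : (\sum_(j < n) j%:R *: A ^+ j) *m (A - 1) = n%:R *: 1.
    by rewrite [LHS]sum_mulrn_expr_sub1 sumA mulr0 subr0 An.
  by rewrite -scalemxAl mul1mx.
rewrite -[e 1]scale1r -(mulVf n0) -scalerA ny.
have -> : n%:R^-1 = ratr n%:R^-1 :> R by rewrite fmorphV rmorph_nat.
apply: rot_spanZ; apply: rot_span_sum => j _.
have -> : (j : nat)%:R = ratr j%:R :> R by rewrite rmorph_nat.
rewrite -umxX; apply/rot_spanZ/rot_span_mul; rewrite yE.
apply: rot_spanD; last exact/rot_spanN/rot_span_tside0.
by have := rot_span_tside0 1%g; rewrite umx1 mul1mx.
Qed.

Lemma rot_span_tside i : rot_span (e i).
Proof.
have e0 : rot_span (e 0) by have := rot_span_tside0 1%g; rewrite umx1 mul1mx.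
move: i; apply: ord3P => //; first exact: rot_span_tside1.
by rewrite tside2; apply/rot_spanN/rot_spanD => //; exact: rot_span_tside1.
Qed.

(** The point is that [c] does not depend on [g]: as a function of [g], the cross product is a
    rational combination of translates of a single function. *)
Lemma cross_rot_span v x : rot_span v -> rot_span x ->
  exists c : unfold_gT -> rat, {in rotations, forall g,
    cross v (umx g *m x) =
    \sum_(l in rotations) ratr (c l) * cross (e 0) (umx (l * g)%g *m e 0)}.
Proof.
(* The term of [a h] and [b k] depends on [h] and [k] only through [l = h^-1 k], because [h]
   preserves the cross product and commutes with [g]. *)
move=> [a ->] [b ->]; exists (fun l => \sum_(h in rotations) a h * b (h * l)%g).
move=> g gH; rewrite cross_suml.
transitivity (\sum_(h in rotations) \sum_(l in rotations)
    ratr (a h * b (h * l)%g) * cross (e 0) (umx (l * g)%g *m e 0)); last first.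
  rewrite exchange_big; apply: eq_bigr => l _.
  by rewrite rmorph_sum mulr_suml.
apply: eq_bigr => h hH; rewrite mulmx_sumr cross_sumr (reindex_inj (mulgI h)) /=.
apply: eq_big => [l|l]; first by rewrite groupMl.
rewrite groupMl // => lH; rewrite -scalemxAr crossZl crossZr mulrA -rmorphM.
rewrite mulmxA -umxM (centsP rotations_abelian g gH (h * l)%g) ?groupMl //.
by rewrite -mulgA umxM -mulmxA cross_mulmx det_rotation // mul1r.
Qed.

(** Applying [g] to both arguments preserves the cross product and moves [g] to the first one;
    antisymmetry does the rest. *)
Lemma cross_rotV g : g \in rotations ->
  cross (e 0) (umx g^-1%g *m e 0) = - cross (e 0) (umx g *m e 0).
Proof.
move=> gH; rewrite -[LHS]mul1r -(det_rotation gH) -cross_mulmx mulmxA -umxM mulgV.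
by rewrite umx1 mul1mx /cross; ring.
Qed.

Lemma sum_rotations_wedge (s : R) v x y :
  rot_span v -> rot_span x -> rot_span y ->
  \sum_(g in rotations) wedge (s * cross v (umx g *m x) : R^o)
                              (s * cross v (umx g *m y) : R^o) = 0.
Proof.
move=> hv hx hy; have [c hc] := cross_rot_span hv hx.
have [d hd] := cross_rot_span hv hy.
(* The real factor [s] cannot leave a wedge over the rationals, so it is absorbed into the odd
   function. *)
pose f g : R^o := s * cross (e 0) (umx g *m e 0).
have oddf : {in rotations, forall g, f g^-1%g = - f g}.
  by move=> g gH; rewrite /f cross_rotV // mulrN.
rewrite -[RHS](sum_wedge_odd rotations_abelian oddf c d).
apply: eq_bigr => g gH; rewrite hc // hd // !mulr_sumr.
by congr wedge; apply: eq_bigr => h _; rewrite /f mulrCA.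
Qed.

(** * Holonomy and SAF invariant of the unfolding *)

Lemma holonomy_rot_span u : holonomy (unfolding hP) u -> rot_span u.
Proof.
move=> [c _ ->]; apply: rot_span_sum => -[g i] _; apply: rot_spanZ.
rewrite /= /unfold_side.
have := rot_span_mul g (rot_span_tside (side_label P (umx (g : unfold_gT)) i)).
by case: flipped; rewrite ?scaleN1r ?scale1r //; exact: rot_spanN.
Qed.

Lemma flipped_rotation g : g \in rotations ->
  flipped P (umx g) = (cross (e 0) (e 1) < 0).
Proof. by move=> /det_rotation d1; rewrite /flipped cross_mulmx d1 mul1r. Qed.

(** Among copies of one orientation, the sign and the relabelling are constant and go into [x]. Each
    coset of the rotations thus contributes a sum of the form in [sum_rotations_wedge]. *)
Lemma unfold_side_flipped (b : bool) i : exists x, rot_span x /\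
  forall g, flipped P (umx g) = b -> unfold_side (g : unfold_group P) i = umx g *m x.
Proof.
exists ((-1) ^+ b *: e (if b then rev_ord i else i)); split=> [|g gb].
  by case: b; rewrite ?scaleN1r ?scale1r; [apply: rot_spanN|]; exact: rot_span_tside.
by rewrite /unfold_side /side_label -[val _]/(umx g) gb scalemxAr.
Qed.

Lemma sum_unfold_wedge (s : R) v : rot_span v ->
  \sum_(g : unfold_gT)
     wedge (s * cross v (unfold_side (g : unfold_group P) 0) : R^o)
           (s * cross v (unfold_side (g : unfold_group P) 1) : R^o) = 0.
Proof.
move=> hv; rewrite (bigID (mem rotations)) /=.
have [x0 [hx0 s0]] := unfold_side_flipped (cross (e 0) (e 1) < 0) 0.
have [x1 [hx1 s1]] := unfold_side_flipped (cross (e 0) (e 1) < 0) 1.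
have [y0 [hy0 t0]] := unfold_side_flipped (~~ (cross (e 0) (e 1) < 0)) 0.
have [y1 [hy1 t1]] := unfold_side_flipped (~~ (cross (e 0) (e 1) < 0)) 1.
rewrite -[RHS]addr0; congr (_ + _).
  rewrite -[RHS](sum_rotations_wedge s hv hx0 hx1).
  by apply: eq_bigr => g gH; rewrite s0 ?s1 // flipped_rotation.
(* The non-rotations are the products [g * uref 0] with [g] a rotation; [uref 0] is moved onto the
   vectors, which stay in the span. *)
have hr y : rot_span y -> rot_span (umx (uref 0%R) *m y) := @rot_span_mul _ y.
rewrite -[RHS](sum_rotations_wedge s hv (hr _ hy0) (hr _ hy1)).
rewrite (reindex_inj (mulIg (uref 0%R))) /=.
apply: eq_big => g; first by rewrite mul_uref_rotation negbK.
rewrite mul_uref_rotation negbK => gH.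
have fg : flipped P (umx (g * uref 0%R)%g) = ~~ (cross (e 0) (e 1) < 0).
  by rewrite umxM (flipped_mul 0 (umxP g)) flipped_rotation.
by rewrite t0 // t1 // umxM !mulmxA.
Qed.

End UnfoldingGroup.

HB.instance Definition _ (F : numFieldType) (V W : lmodType F)
    (f : {linear V -> W}) :=
  GRing.isZmodMorphism.Build (ext2 V) (ext2 W) (ext2_map f)
    (ext2_map_zmod_morphism f).

Theorem theorem1p4 (R : realType) (P : triangle R) (hP : rational_triangle P) :
  completely_algebraically_periodic (unfolding hP).
Proof.
move=> _ [h [/holonomy_rot_span hh _ [a _ ->]]].
rewrite /algebraically_periodic /SAF /J_invariant raddf_sum.
(* This factor turns [cross h] into the normalized projection [oproj (a *: h)]. *)
rewrite -[RHS](sum_unfold_wedge (a / enorm (a *: h)) hh).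
apply: eq_bigr => g _; rewrite [LHS]ext2_map_wedge /= /oproj.
by congr wedge; rewrite crossZl mulrAC.
Qed.
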